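(* Let $\ell_1,\ell_2,\ell_3,\ell_4,m_1,m_2,m_3,m_4$ be eight generic oriented lines in the hyperbolic, elliptic, or Euclidean plane, such that the five quadrilaterals $(\ell_1,\ell_2,m_1,m_2)$, $(\ell_1,\ell_2,m_3,m_4)$, $(\ell_3,\ell_4,m_1,m_2)$, $(\ell_3,\ell_4,m_3,m_4)$, $(\ell_2,\ell_3,m_2,m_3)$ are circumscribed (the four lines of each touch a common oriented circle). Then so is the quadrilateral $(\ell_1,\ell_4,m_1,m_4)$.
   Context: Let $\varepsilon=-1,1,0$ in the hyperbolic, elliptic, Euclidean case, respectively. The Laguerre quadric is $$\mathcal{B}=\{[x]\in\mathbb{R}\mathrm{P}^3: x_1^2+x_2^2+\varepsilon x_3^2-x_4^2=0\}.$$ Oriented lines of the respective plane are identified with points of $\mathcal{B}$ (for $\varepsilon=0$ excluding the vertex $[0,0,1,0]$): the point $[x_1,x_2,x_3,x_4]$ represents the line $\{[y_1,y_2,y_3] : x_1y_1+x_2y_2+\varepsilon' x_3y_3=0\}$ in homogeneous coordinates of the plane, where $\varepsilon'=\varepsilon$ if $\varepsilon\neq 0$ and $\varepsilon'=1$ if $\varepsilon=0$, and $[x_1,x_2,x_3,-x_4]$ represents the same line with opposite orientation. Oriented (Laguerre) circles are identified with planar sections of $\mathcal{B}$, an oriented line touching (being in oriented contact with) the oriented circle if its point lies on the planar section. Thus four oriented lines touch a common oriented circle (the quadrilateral is circumscribed) if and only if the four corresponding points of $\mathcal{B}$ are coplanar; this is the convention in all cases, including tangent planes and, in the hyperbolic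 case, circles enveloped outside the hyperbolic plane. Regarding ''generic'': as for the corresponding theorem on oriented circles in Lie geometry, of which this is the Laguerre geometric version, a sufficient genericity condition for the eight points on the quadric is that no five of them are coplanar.
   Formalization: ''Generic'' is taken to mean that no five of the eight points are coplanar and that the lines spanned by the pairs l1l2, l3l4, m1m2, m3m4 do not all lie on the Laguerre quadric; without the second condition the claim fails in the hyperbolic case. *)

(* Defs.v *)
From HB Require Import structures.
From mathcomp Require Import all_boot all_order all_algebra.
From mathcomp Require Import reals.

Set Implicit Arguments.
Unset Strict Implicit.
Unset Printing Implicit Defensive.

Import Order.TTheory GRing.Theory Num.Theory.
Local Open Scope ring_scope.

(* Points of RP^3 are given by nonzero representatives in 'rV[R]_4, and planes
   by nonzero covectors in 'cV[R]_4. Every notion below is invariant under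
   rescaling of representatives. The homogeneous coordinates x_1, ..., x_4 are
   x 0 0, ..., x 0 3. *)

Inductive geometry := Hyperbolic | Elliptic | Euclidean.

Definition epsilon (R : realType) (g : geometry) : R :=
  match g with
  | Hyperbolic => -1
  | Elliptic => 1
  | Euclidean => 0
  end.

Definition laguerre_form (R : realType) (g : geometry) (x : 'rV[R]_4) : R :=
  x 0 0 ^+ 2 + x 0 1 ^+ 2 + epsilon R g * x 0 2 ^+ 2 - x 0 3 ^+ 2.

Definition on_laguerre_quadric (R : realType) (g : geometry) (x : 'rV[R]_4) :
    Prop :=
  laguerre_form g x = 0.

(* The point [0, 0, 1, 0], for a nonzero representative x. *)
Definition is_vertex (R : realType) (x : 'rV[R]_4) : Prop :=
  [/\ x 0 0 = 0, x 0 1 = 0 & x 0 3 = 0].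

Record oriented_line (R : realType) (g : geometry) := OrientedLine {
  line_coords :> 'rV[R]_4;
  line_coords_neq0 : line_coords != 0;
  line_on_quadric : on_laguerre_quadric g line_coords;
  line_not_vertex : g = Euclidean -> ~ is_vertex line_coords
}.

(* An oriented circle is a planar section of the quadric, given by its plane.
   No plane is excluded: tangent planes, planes through the vertex of the cone
   (Euclidean case), and planes of circles enveloped outside the hyperbolic
   plane are all allowed. *)
Record oriented_circle (R : realType) := OrientedCircle {
  circle_plane :> 'cV[R]_4;
  circle_plane_neq0 : circle_plane != 0
}.

Definition touches (R : realType) (g : geometry)
    (l : oriented_line R g) (C : oriented_circle R) : Prop :=
  (l : 'rV[R]_4) *m (C : 'cV[R]_4) = 0.

Definition circumscribed (R : realType) (g : geometry)
    (a b c d : oriented_line R g) : Prop :=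
  exists C : oriented_circle R,
    [/\ touches a C, touches b C, touches c C & touches d C].

Definition coplanar (R : realType) (s : seq 'rV[R]_4) : Prop :=
  exists2 C : 'cV[R]_4, C != 0 & forall x, x \in s -> x *m C = 0.

(* "Five of the points" means five positions of the list s. *)
Definition no_five_coplanar (R : realType) (s : seq 'rV[R]_4) : Prop :=
  forall t : seq 'rV[R]_4, subseq t s -> size t = 5 -> ~ coplanar t.

(* The line of RP^3 spanned by x and y is contained in the quadric. In plane
   terms: x and y are consistently oriented lines of one parabolic (parallel)
   pencil. This never happens for distinct points in the elliptic case. *)
Definition span_generator (R : realType) (g : geometry) (x y : 'rV[R]_4) :
    Prop :=
  forall a b : R, on_laguerre_quadric g (a *: x + b *: y).

(* The condition on five points does not suffice in the ruled cases. If l1 l2,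
   l3 l4, m1 m2 and m3 m4 are all generators of the quadric (in the hyperbolic
   case forming a skew quadrilateral, in the Euclidean case four generators of
   the cone), then four of the five coplanarities in the theorem hold for free,
   and the remaining one does not imply the conclusion, even when no five of
   the eight points are coplanar. Only this configuration is excluded. *)
Definition generic (R : realType) (g : geometry)
    (l1 l2 l3 l4 m1 m2 m3 m4 : oriented_line R g) : Prop :=
  no_five_coplanar [:: (l1 : 'rV[R]_4); (l2 : 'rV[R]_4); (l3 : 'rV[R]_4);
    (l4 : 'rV[R]_4); (m1 : 'rV[R]_4); (m2 : 'rV[R]_4); (m3 : 'rV[R]_4);
    (m4 : 'rV[R]_4)] /\
  ~ [/\ span_generator g l1 l2, span_generator g l3 l4,
        span_generator g m1 m2 & span_generator g m3 m4].

(* Main.v *)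
(** Each coplanar quadruple of the form l l m m gives a relation
    a l + a' l' = b m + b' m', whose coefficients are all nonzero since no five of
    the points are coplanar. Taking the quadratic form of both sides shows that
    the polars <l, l'>, <m, m'> of the four pairs vanish simultaneously; if they all
    vanished, the pairs would span generators, so they are all nonzero.
    The four lines spanned by the pairs then form a skew quadrilateral or concur.
    In a skew quadrilateral, Carnot's theorem for the quadric on its sides and
    Menelaus' theorem for the plane through l2, l3, m2, m3 give Menelaus' relation
    for l1, l4, m1, m4. If the lines concur in P, then P is not on the quadric, and
    the reflection in P takes l2, l3, m2, m3 to l1, l4, m1, m4. *)

Require Import Defs.
From mathcomp Require Import all_boot all_order all_algebra.
From mathcomp Require Import reals.
From mathcomp Require Import ring.

Set Implicit Arguments.
Unset Strict Implicit.
Unset Printing Implicit Defensive.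

Import Order.TTheory GRing.Theory Num.Theory.
Local Open Scope ring_scope.

(** * Linear dependence and coplanarity of four points *)

Definition dependent (F : fieldType) (x y z w : 'rV[F]_4) : Prop :=
  exists a b c d : F, ~~ [&& a == 0, b == 0, c == 0 & d == 0] /\
    a *: x + b *: y + c *: z + d *: w = 0.

(** The coefficients of a dependence form a left kernel vector of the matrix [M] with these rows, a
    common plane is a right kernel vector; either exists exactly when [\det M] vanishes. *)
Lemma dependentP (F : fieldType) (x y z w : 'rV[F]_4) :
  dependent x y z w <->
  exists2 C : 'cV[F]_4, C != 0 &
    [/\ x *m C = 0, y *m C = 0, z *m C = 0 & w *m C = 0].
Proof.
pose u (i : 'I_4) := tnth [tuple x; y; z; w] i.
pose M : 'M[F]_4 := \matrix_i u i.
have rowM i : row i M = u i by rewrite rowK.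
have mulE (v : 'rV[F]_4) :
    v *m M = v 0 0 *: x + v 0 1 *: y + v 0 2 *: z + v 0 3 *: w.
  rewrite mulmx_sum_row !big_ord_recl big_ord0 !rowM addr0 !addrA.
  by congr (_ *: _ + _ *: _ + _ *: _ + _ *: _); congr (v _ _); apply: val_inj.
split=> [[a [b [c [d [nz e]]]]]|[C nzC [hx hy hz hw]]].
- have : \det M == 0.
    pose v : 'rV[F]_4 := \row_i tnth [tuple a; b; c; d] i.
    apply/det0P; exists v; last by rewrite mulE !mxE.
    apply: contra nz => /eqP/rowP v0.
    have a0 : a = 0 by have := v0 0; rewrite !mxE.
    have b0 : b = 0 by have := v0 1; rewrite !mxE.
    have c0 : c = 0 by have := v0 2; rewrite !mxE.
    have d0 : d = 0 by have := v0 3; rewrite !mxE.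
    by rewrite a0 b0 c0 d0 eqxx.
  rewrite -det_tr => /det0P[v nzv /(congr1 trmx)]; rewrite trmx_mul trmxK trmx0.
  move=> Mv; exists v^T; first by rewrite -(inj_eq trmx_inj) trmxK trmx0.
  have uv i : u i *m v^T = 0 by rewrite -rowM -row_mul Mv row0.
  by split; [exact: (uv 0)|exact: (uv 1)|exact: (uv 2)|exact: (uv 3)].
- have : \det M == 0.
    rewrite -det_tr; apply/det0P; exists C^T.
      by rewrite -(inj_eq trmx_inj) trmxK trmx0.
    rewrite -trmx_mul (_ : M *m C = 0) ?trmx0 //.
    by apply/row_matrixP=> i; rewrite row_mul rowM row0; case: i => [[|[|[|[|]]]]].
  move=> /det0P[v nzv]; rewrite mulE => e.
  exists (v 0 0), (v 0 1), (v 0 2), (v 0 3); split=> //.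
  apply: contra nzv => /and4P[/eqP v0 /eqP v1 /eqP v2 /eqP v3].
  apply/eqP/rowP=> -[[|[|[|[|//]]]] i]; rewrite mxE;
    [rewrite -[RHS]v0|rewrite -[RHS]v1|rewrite -[RHS]v2|rewrite -[RHS]v3];
    by congr (v _ _); apply: val_inj.
Qed.

(** * The bilinear form polarizing [laguerre_form] *)

Definition polar (R : realType) (g : geometry) (x y : 'rV[R]_4) : R :=
  x 0 0 * y 0 0 + x 0 1 * y 0 1 + epsilon R g * (x 0 2 * y 0 2)
  - x 0 3 * y 0 3.

Section Polar.
Variables (R : realType) (g : geometry).
Implicit Types (x y z w : 'rV[R]_4).

Lemma polarC x y : polar g x y = polar g y x.
Proof. by rewrite /polar; ring. Qed.

Lemma polarDl x y z : polar g (x + y) z = polar g x z + polar g y z.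
Proof. by rewrite /polar !mxE; ring. Qed.

Lemma polarZl a x y : polar g (a *: x) y = a * polar g x y.
Proof. by rewrite /polar !mxE; ring. Qed.

Lemma polar0l x : polar g 0 x = 0.
Proof. by rewrite /polar !mxE; ring. Qed.

(** The square terms vanish on the quadric, which leaves the mixed term. *)
Lemma laguerre_form_comb a b x y :
  on_laguerre_quadric g x -> on_laguerre_quadric g y ->
  laguerre_form g (a *: x + b *: y) = 2 * (a * b * polar g x y).
Proof.
rewrite /on_laguerre_quadric => qx qy.
transitivity (a ^+ 2 * laguerre_form g x + b ^+ 2 * laguerre_form g y
  + 2 * (a * b * polar g x y)); last by rewrite qx qy; ring.
by rewrite /laguerre_form /polar !mxE; ring.
Qed.

Lemma polar0_span_generator x y :
  on_laguerre_quadric g x -> on_laguerre_quadric g y -> polar g x y = 0 ->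
  span_generator g x y.
Proof.
by move=> qx qy xy0 a b; rewrite /on_laguerre_quadric laguerre_form_comb // xy0;
  ring.
Qed.

Lemma polar_concurrent a b c d x y z w :
  on_laguerre_quadric g x -> on_laguerre_quadric g y ->
  on_laguerre_quadric g z -> on_laguerre_quadric g w ->
  a *: x + b *: y = c *: z + d *: w ->
  a * b * polar g x y = c * d * polar g z w.
Proof.
move=> qx qy qz qw /(congr1 (laguerre_form g)).
by rewrite !laguerre_form_comb //; apply: mulfI; rewrite pnatr_eq0.
Qed.

(** Since [polar g y y] vanishes, only the mixed term survives in [polar g y P]. This determines the
    reflection in [P] at [y]. *)
Lemma polar_comb a b x y P :
  on_laguerre_quadric g x -> on_laguerre_quadric g y ->
  P = a *: x + b *: y -> 2 * (b * polar g y P) = laguerre_form g P.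
Proof.
move=> qx qy ->; rewrite laguerre_form_comb // polarC polarDl !polarZl.
have -> : polar g y y = laguerre_form g y by rewrite /polar /laguerre_form; ring.
by rewrite qy mulr0 addr0; ring.
Qed.

End Polar.

(** Serves to show that a plane through four of the eight points misses the other four. *)
Lemma no_five_coplanar_count (R : realType) (s : seq 'rV[R]_4) (C : 'cV[R]_4) :
  no_five_coplanar s -> C != 0 -> (count (fun x : 'rV[R]_4 => x *m C == 0)%R s < 5)%N.
Proof.
move=> nf nzC; rewrite ltnNge -size_filter; apply/negP => le5.
apply: (nf (take 5 [seq x <- s | x *m C == 0])).
- exact: subseq_trans (take_subseq _ _) (filter_subseq _ _).
- by rewrite size_takel.
- by exists C => // x /mem_take; rewrite mem_filter => /andP[/eqP].
Qed.

(** * Relations among coplanar points and the lines spanned by the pairs *)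

Section FieldVectors.
Variable F : fieldType.
Implicit Types (x y z w : 'rV[F]_4) (C : 'cV[F]_4).

(* The three planes force all coefficients to be nonzero; the value at [C3] is
   the ratio that enters Menelaus' theorem. *)
Lemma coplanar_relation x y z w C1 C2 C3 :
  dependent x y z w ->
  x *m C1 = 0 -> y *m C1 = 0 -> z *m C1 != 0 -> w *m C1 != 0 ->
  z *m C2 = 0 -> w *m C2 = 0 -> x *m C2 != 0 -> y *m C2 != 0 ->
  y *m C3 = 0 -> w *m C3 = 0 -> x *m C3 != 0 -> z *m C3 != 0 ->
  exists a b c d : F, [/\ [/\ a != 0, b != 0, c != 0 & d != 0],
    a *: x + b *: y = c *: z + d *: w &
    a * (x *m C3) 0 0 = c * (z *m C3) 0 0].
Proof.
move=> [a [b [c [d [nz e]]]]] x1 y1 z1 w1 z2 w2 x2 y2 y3 w3 x3 z3.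
have e1 : a *: x + b *: y = (- c) *: z + (- d) *: w.
  by apply/eqP; rewrite -subr_eq0 !scaleNr opprD !opprK !addrA e.
have ev C : a *: (x *m C) + b *: (y *m C) + c *: (z *m C) + d *: (w *m C) = 0.
  by rewrite !scalemxAl -!mulmxDl e mul0mx.
have ev1 := ev C1; have ev2 := ev C2; have ev3 := ev C3.
rewrite x1 y1 !scaler0 !add0r in ev1.
rewrite z2 w2 !scaler0 !addr0 in ev2.
rewrite y3 w3 !scaler0 !addr0 in ev3.
have trans (k l : F) (u v : 'M[F]_1) :
    k *: u + l *: v = 0 -> v != 0 -> k = 0 -> l = 0.
  move=> + nv k0; rewrite k0 scale0r add0r => /eqP.
  by rewrite scaler_eq0 (negPf nv) orbF => /eqP.
have ev1' := ev1; rewrite addrC in ev1'.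
have ev2' := ev2; rewrite addrC in ev2'.
have ev3' := ev3; rewrite addrC in ev3'.
(* [C2] links [a] with [b], [C1] links [c] with [d], and [C3] links [a] with [c]: one zero
   coefficient would make all four zero. *)
have ab := trans _ _ _ _ ev2 y2; have ba := trans _ _ _ _ ev2' x2.
have cd := trans _ _ _ _ ev1 w1; have dc := trans _ _ _ _ ev1' z1.
have ac := trans _ _ _ _ ev3 z3; have ca := trans _ _ _ _ ev3' x3.
have na : a != 0.
  apply: contra nz => /eqP a0.
  by rewrite a0 (ab a0) (ac a0) (cd (ac a0)) eqxx.
have nc : c != 0 by apply: contra na => /eqP/ca ->.
exists a, b, (- c), (- d); split=> //.
- rewrite !oppr_eq0; split=> //.
    by apply: contra na => /eqP/ba ->.
  by apply: contra nc => /eqP/dc ->.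
- apply/eqP; rewrite -subr_eq0 mulNr opprK; apply/eqP.
  by have := congr1 (fun u : 'M_1 => u 0 0) ev3; rewrite !mxE.
Qed.

End FieldVectors.

(* The reflection fixing the hyperplane polar to [P] exchanges the two points of
   the quadric on each line through [P]. *)
Lemma dependent_concurrent (R : realType) (g : geometry)
    (p p' q q' r r' s s' P : 'rV[R]_4) (a a' b b' c c' d d' : R) :
  on_laguerre_quadric g p -> on_laguerre_quadric g p' ->
  on_laguerre_quadric g q -> on_laguerre_quadric g q' ->
  on_laguerre_quadric g r -> on_laguerre_quadric g r' ->
  on_laguerre_quadric g s -> on_laguerre_quadric g s' ->
  [/\ a != 0, b != 0, c != 0 & d != 0] ->
  [/\ a' != 0, b' != 0, c' != 0 & d' != 0] ->
  P = a *: p + a' *: p' -> P = b *: q + b' *: q' ->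
  P = c *: r + c' *: r' -> P = d *: s + d' *: s' ->
  laguerre_form g P != 0 ->
  dependent p' q' r' s' -> dependent p q r s.
Proof.
move=> hp hp' hq hq' hr hr' hs hs' [a0 b0 c0 d0] [a0' b0' c0' d0'].
move=> Pp Pq Pr Ps N0 [k [l [m [n [nz e]]]]].
(* This is the coefficient of [P] left over when [p'], [q'], [r'], [s'] are reflected; it vanishes
   by pairing the given relation with [P]. *)
have sum0 : k / a' + l / b' + m / c' + n / d' = 0.
  have := congr1 (fun x => polar g x P) e; rewrite !polarDl !polarZl polar0l.
  move=> e'; apply: (mulfI N0); rewrite mulr0.
  have scale z y x : y != 0 -> 2 * (y * polar g x P) = laguerre_form g P ->
      laguerre_form g P * (z / y) = 2 * (z * polar g x P).
    by move=> y0 <-; field.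
  rewrite !mulrDr (scale _ _ _ a0' (polar_comb hp hp' Pp)).
  rewrite (scale _ _ _ b0' (polar_comb hq hq' Pq)).
  rewrite (scale _ _ _ c0' (polar_comb hr hr' Pr)).
  rewrite (scale _ _ _ d0' (polar_comb hs hs' Ps)).
  by rewrite -!mulrDr e' mulr0.
(* The reflection takes [a' *: p'] to [a' *: p' - P = - (a *: p)], so these are the reflected
   coefficients up to a common sign. *)
exists (k / a' * a), (l / b' * b), (m / c' * c), (n / d' * d); split.
  by rewrite !mulf_eq0 !invr_eq0 (negPf a0) (negPf b0) (negPf c0) (negPf d0)
    (negPf a0') (negPf b0') (negPf c0') (negPf d0') !orbF.
have image (x y : R) (u v : 'rV[R]_4) z : y != 0 -> P = x *: u + y *: v ->
    (z / y * x) *: u = (z / y) *: P - z *: v.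
  by move=> y0 ->; apply/rowP=> t; rewrite !mxE; field.
rewrite (image _ _ _ _ _ a0' Pp) (image _ _ _ _ _ b0' Pq).
rewrite (image _ _ _ _ _ c0' Pr) (image _ _ _ _ _ d0' Ps).
transitivity ((k / a' + l / b' + m / c' + n / d') *: P
  - (k *: p' + l *: q' + m *: r' + n *: s')); last first.
  by rewrite sum0 e scale0r subrr.
by apply/rowP=> t; rewrite !mxE; ring.
Qed.

(* Multiplying the four relations among forms is Carnot's theorem for the
   quadrilateral of the lines [pp'], [rr'], [qq'], [ss']; multiplying their values
   at [p], [q], [r], [s] is Menelaus' theorem. *)
Lemma dependent_quadrilateral (R : realType) (g : geometry)
    (p p' q q' r r' s s' : 'rV[R]_4) (a a' b b' c c' d d' e e' f f' h h' i i' : R)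
    (tp tq tr ts : R) :
  on_laguerre_quadric g p -> on_laguerre_quadric g p' ->
  on_laguerre_quadric g q -> on_laguerre_quadric g q' ->
  on_laguerre_quadric g r -> on_laguerre_quadric g r' ->
  on_laguerre_quadric g s -> on_laguerre_quadric g s' ->
  [/\ a != 0, a' != 0, b != 0 & b' != 0] ->
  [/\ c != 0, c' != 0, d != 0 & d' != 0] ->
  [/\ e != 0, e' != 0, f != 0 & f' != 0] ->
  [/\ h != 0, h' != 0, i != 0 & i' != 0] ->
  a *: p + a' *: p' = b *: r + b' *: r' ->
  c *: p + c' *: p' = d *: s + d' *: s' ->
  e *: q + e' *: q' = f *: r + f' *: r' ->
  h *: q + h' *: q' = i *: s + i' *: s' ->
  a * tp = b * tr -> c * tp = d * ts -> e * tq = f * tr -> h * tq = i * ts ->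
  [/\ tp != 0, tq != 0, tr != 0 & ts != 0] ->
  [/\ polar g p p' != 0, polar g q q' != 0, polar g r r' != 0 &
      polar g s s' != 0] ->
  dependent p' q' r' s' -> dependent p q r s.
Proof.
move=> hp hp' hq hq' hr hr' hs hs' [a0 a0' b0 b0'] [c0 c0' d0 d0']
  [e0 e0' f0 f0'] [h0 h0' i0 i0'] E1 E2 E3 E4 t1 t2 t3 t4 [p0 q0 r0 s0]
  [pp0 qq0 rr0 ss0] dep.
have N1 := polar_concurrent hp hp' hr hr' E1.
have N2 := polar_concurrent hp hp' hs hs' E2.
have N3 := polar_concurrent hq hq' hr hr' E3.
have N4 := polar_concurrent hq hq' hs hs' E4.
have menelaus : a * d * f * h = b * c * e * i.
  apply: (mulfI (mulf_neq0 (mulf_neq0 p0 q0) (mulf_neq0 r0 s0))).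
  transitivity ((a * tp) * (d * ts) * (f * tr) * (h * tq)); first by ring.
  by rewrite t1 -t2 -t3 t4; ring.
have carnot : (a * a') * (d * d') * (f * f') * (h * h')
    = (b * b') * (c * c') * (e * e') * (i * i').
  apply: (mulfI (mulf_neq0 (mulf_neq0 pp0 qq0) (mulf_neq0 rr0 ss0))).
  transitivity ((a * a' * polar g p p') * (d * d' * polar g s s')
    * (f * f' * polar g r r') * (h * h' * polar g q q')); first by ring.
  by rewrite N1 -N2 -N3 N4; ring.
(* Carnot's relation divided by Menelaus' leaves the one among primed coefficients, which is
   Menelaus' relation for [p], [q], [r], [s]. *)
have K : a' * d' * f' * h' = b' * c' * e' * i'.
  apply: (mulfI (mulf_neq0 (mulf_neq0 a0 d0) (mulf_neq0 f0 h0))).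
  transitivity ((a * a') * (d * d') * (f * f') * (h * h')); first by ring.
  rewrite carnot; transitivity ((b * c * e * i) * (b' * c' * e' * i')).
    by ring.
  by rewrite -menelaus; ring.
(* Weights for the four relations: [p'], [r'] and [s'] cancel identically in the weighted sum, and
   [q'] cancels by [K]. *)
pose x1 := c' * f' * i'; pose x2 := - (a' * f' * i').
pose x3 := - (b' * c' * i').
pose x4 := a' * f' * d'.
have x10 : x1 != 0 by rewrite !mulf_neq0.
have x20 : x2 != 0 by rewrite oppr_eq0 !mulf_neq0.
have x30 : x3 != 0 by rewrite oppr_eq0 !mulf_neq0.
have comb : (x1 * a + x2 * c) *: p + (x3 * e + x4 * h) *: q
    + (- (x1 * b + x3 * f)) *: r + (- (x2 * d + x4 * i)) *: s = 0.
  have rel (u v : 'rV[R]_4) : u = v -> u - v = 0 by move=> ->; rewrite subrr.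
  transitivity (x1 *: (a *: p + a' *: p' - (b *: r + b' *: r'))
    + x2 *: (c *: p + c' *: p' - (d *: s + d' *: s'))
    + x3 *: (e *: q + e' *: q' - (f *: r + f' *: r'))
    + x4 *: (h *: q + h' *: q' - (i *: s + i' *: s'))); last first.
    by rewrite !rel // !scaler0 !addr0.
  apply/rowP=> j; rewrite !mxE /x1 /x2 /x3 /x4.
  apply/eqP; rewrite -subr_eq0; apply/eqP.
  transitivity ((b' * c' * e' * i' - a' * d' * f' * h') * q' 0 j).
    by ring.
  by rewrite K subrr mul0r.
(* If the weighted sum is trivial, relations sharing a pair become proportional on it, so that the
   four lines concur in [P]. *)
have [z|nz] := boolP [&& x1 * a + x2 * c == 0, x3 * e + x4 * h == 0,
  - (x1 * b + x3 * f) == 0 & - (x2 * d + x4 * i) == 0]; last first.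
  by exists (x1 * a + x2 * c), (x3 * e + x4 * h), (- (x1 * b + x3 * f)),
    (- (x2 * d + x4 * i)).
case/and4P: z; rewrite !oppr_eq0 => /eqP z1 _ /eqP z3 _.
pose P := a *: p + a' *: p'.
have N0 : laguerre_form g P != 0.
  by rewrite laguerre_form_comb // !mulf_neq0 // pnatr_eq0.
have prop y m n : x1 * m + y * n = 0 -> m = - (y / x1) * n.
  move=> eq0; apply: (mulfI x10); transitivity (- (y * n)); last by field.
  by apply/eqP; rewrite -addr_eq0 eq0.
have ac : a = - (x2 / x1) * c by apply: prop.
have ac' : a' = - (x2 / x1) * c' by apply: prop; rewrite /x1 /x2; ring.
have bf : b = - (x3 / x1) * f by apply: prop.
have bf' : b' = - (x3 / x1) * f' by apply: prop; rewrite /x1 /x3; ring.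
have k0 : - (x2 / x1) != 0 by rewrite oppr_eq0 mulf_neq0 // invr_eq0.
have l0 : - (x3 / x1) != 0 by rewrite oppr_eq0 mulf_neq0 // invr_eq0.
have Ps : P = (- (x2 / x1) * d) *: s + (- (x2 / x1) * d') *: s'.
  by rewrite /P {1}ac {1}ac' -!scalerA -!scalerDr E2.
have Pq : P = (- (x3 / x1) * e) *: q + (- (x3 / x1) * e') *: q'.
  by rewrite /P E1 {1}bf {1}bf' -!scalerA -!scalerDr E3.
by apply: (dependent_concurrent hp hp' hq hq' hr hr' hs hs' _ _ erefl Pq E1 Ps);
  rewrite // ?mulf_neq0.
Qed.

(** * Circumscribed quadrilaterals *)

Section Circumscribed.
Variables (R : realType) (g : geometry).
Implicit Types a b c d : oriented_line R g.

Lemma circumscribedP a b c d : circumscribed a b c d <-> dependent a b c d.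
Proof.
rewrite dependentP; split=> [[C h]|[C nzC h]].
  by exists C => //; exact: circle_plane_neq0.
by exists (OrientedCircle nzC).
Qed.

Lemma polar_relation (a b c d : oriented_line R g) (x y z w : R) :
  [/\ x != 0, y != 0, z != 0 & w != 0] ->
  x *: (a : 'rV[R]_4) + y *: (b : 'rV[R]_4)
    = z *: (c : 'rV[R]_4) + w *: (d : 'rV[R]_4) ->
  (polar g a b == 0) = (polar g c d == 0).
Proof.
move=> [x0 y0 z0 w0] /(polar_concurrent (line_on_quadric a) (line_on_quadric b)
  (line_on_quadric c) (line_on_quadric d)) /(congr1 (fun t => t == 0)).
by rewrite !mulf_eq0 (negPf x0) (negPf y0) (negPf z0) (negPf w0).
Qed.

End Circumscribed.

Theorem theorem8p3 (R : realType) (g : geometry)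
    (l1 l2 l3 l4 m1 m2 m3 m4 : oriented_line R g)
    (hgen : generic l1 l2 l3 l4 m1 m2 m3 m4)
    (h1212 : circumscribed l1 l2 m1 m2)
    (h1234 : circumscribed l1 l2 m3 m4)
    (h3412 : circumscribed l3 l4 m1 m2)
    (h3434 : circumscribed l3 l4 m3 m4)
    (h2323 : circumscribed l2 l3 m2 m3) :
  circumscribed l1 l4 m1 m4.
Proof.
have [nf nspan] := hgen.
have count5 (C : oriented_circle R) :=
  no_five_coplanar_count nf (circle_plane_neq0 C).
have dep1 : dependent l1 l2 m1 m2 by apply/circumscribedP.
(* The pairs [l3 l4] and [m3 m4] are reversed so that the second point of each pair lies in the
   plane of [h2323]. *)
have dep2 : dependent l1 l2 m4 m3.
  by apply/circumscribedP; case: h1234 => C [*]; exists C.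
have dep3 : dependent l4 l3 m1 m2.
  by apply/circumscribedP; case: h3412 => C [*]; exists C.
have dep4 : dependent l4 l3 m4 m3.
  by apply/circumscribedP; case: h3434 => C [*]; exists C.
have dep5 : dependent l2 l3 m2 m3 by apply/circumscribedP.
case: h1212 => C1; rewrite /touches => -[A1 A2 A3 A4].
have [A5 A6 A7 A8] : [/\ l3 *m C1 != 0, l4 *m C1 != 0, m3 *m C1 != 0
    & m4 *m C1 != 0].
  by have := count5 C1; rewrite /= A1 A2 A3 A4 !eqxx; do 4!case: eqP.
case: h1234 => C2; rewrite /touches => -[B1 B2 B3 B4].
have [B5 B6 B7 B8] : [/\ l3 *m C2 != 0, l4 *m C2 != 0, m1 *m C2 != 0
    & m2 *m C2 != 0].
  by have := count5 C2; rewrite /= B1 B2 B3 B4 !eqxx; do 4!case: eqP.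
case: h3412 => C3; rewrite /touches => -[D1 D2 D3 D4].
have [D5 D6 D7 D8] : [/\ l1 *m C3 != 0, l2 *m C3 != 0, m3 *m C3 != 0
    & m4 *m C3 != 0].
  by have := count5 C3; rewrite /= D1 D2 D3 D4 !eqxx; do 4!case: eqP.
case: h3434 => C4; rewrite /touches => -[E1 E2 E3 E4].
have [E5 E6 E7 E8] : [/\ l1 *m C4 != 0, l2 *m C4 != 0, m1 *m C4 != 0
    & m2 *m C4 != 0].
  by have := count5 C4; rewrite /= E1 E2 E3 E4 !eqxx; do 4!case: eqP.
case: h2323 => C5; rewrite /touches => -[F1 F2 F3 F4].
have [F5 F6 F7 F8] : [/\ l1 *m C5 != 0, l4 *m C5 != 0, m1 *m C5 != 0
    & m4 *m C5 != 0].
  by have := count5 C5; rewrite /= F1 F2 F3 F4 !eqxx; do 4!case: eqP.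
(* For each relation, two of the planes contain one of its pairs and miss the other; [C5] contains
   just the second point of each pair and gives the Menelaus ratio. *)
have [a [a' [b [b' [nz1 rel1 ev1]]]]] :=
  coplanar_relation dep1 B1 B2 B7 B8 D3 D4 D5 D6 F1 F3 F5 F7.
have [c [c' [d [d' [nz2 rel2 ev2]]]]] :=
  coplanar_relation dep2 A1 A2 A8 A7 E4 E3 E5 E6 F1 F4 F5 F8.
have [e [e' [f [f' [nz3 rel3 ev3]]]]] :=
  coplanar_relation dep3 E2 E1 E7 E8 A3 A4 A6 A5 F2 F3 F6 F7.
have [h [h' [i [i' [nz4 rel4 ev4]]]]] :=
  coplanar_relation dep4 D2 D1 D8 D7 B4 B3 B6 B5 F2 F4 F6 F8.
have eq1 := polar_relation nz1 rel1; have eq2 := polar_relation nz2 rel2.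
have eq3 := polar_relation nz3 rel3.
(* The relations link all four polars, so one zero would make every pair span a generator. *)
have polar_neq0 : polar g l1 l2 != 0.
  apply/negP => l12; have m12 : polar g m1 m2 == 0 by rewrite -eq1.
  have m43 : polar g m4 m3 == 0 by rewrite -eq2.
  have l43 : polar g l4 l3 == 0 by rewrite eq3.
  by apply: nspan; split; apply: polar0_span_generator;
    rewrite ?(eqP l12) ?(eqP m12) ?(polarC g l3) ?(eqP l43) ?(polarC g m3)
      ?(eqP m43) //; exact: line_on_quadric.
have scalar_neq0 (u : 'M[R]_1) : u != 0 -> u 0 0 != 0.
  by apply: contra => /eqP u0; apply/eqP/matrixP=> j k; rewrite !ord1 u0 mxE.
apply/circumscribedP.
apply: (dependent_quadrilateral (line_on_quadric l1) (line_on_quadric l2)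
  (line_on_quadric l4) (line_on_quadric l3) (line_on_quadric m1)
  (line_on_quadric m2) (line_on_quadric m4) (line_on_quadric m3)
  nz1 nz2 nz3 nz4 rel1 rel2 rel3 rel4 ev1 ev2 ev3 ev4 _ _ dep5).
  by split; apply: scalar_neq0.
by split; rewrite // -?eq2 ?eq3 -?eq1.
Qed.
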